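(* Let $(K,L,c)$ be a feasibility problem such that $K = K^{n_1}\times\cdots\times K^{n_m}\subseteq\mathbb{R}^n$ is an extended second order cone, $L\subseteq\mathbb{R}^n$ is a linear subspace and $c\in\mathbb{R}^n$. Suppose that there is $a\in K\cap L$ such that $\mathcal{H}_1(a,K)\cup\mathcal{H}_2(a,K)$ is non-empty. Define the cone $\widetilde{K}=\widetilde{K}^{n_1}\times\cdots\times\widetilde{K}^{n_m}$ such that for every $i$: - $\widetilde{K}^{n_i}=\mathbb{R}^{n_i}$ if $i\in\mathcal{H}_1(a,K)$; - $\widetilde{K}^{n_i}=H_d^{n_i}$ where $d=a_{n_i}'$, if $i\in\mathcal{H}_2(a,K)$; - $\widetilde{K}^{n_i}=K^{n_i}$ otherwise. Then: (i) $(K,L,c)$ is strongly feasible if and only if $(\widetilde{K},L,c)$ is strongly feasible; (ii) $(K,L,c)$ is in weak status if and only if $(\widetilde{K},L,c)$ is in weak status; (iii) $(K,L,c)$ is strongly infeasible if and only if $(\widetilde{K},L,c)$ is strongly infeasible.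
   Context: The Lorentz cone in $\mathbb{R}^{k}$ is $\mathcal{K}^{k}=\{x\in\mathbb{R}^{k}\mid x_0\ge\|\overline{x}\|\}$, where $x=(x_0,\ldots,x_{k-1})$, $\overline{x}=(x_1,\ldots,x_{k-1})$ and $\|\cdot\|$ is the Euclidean norm; $\mathcal{K}^1=\{x\in\mathbb{R}\mid x\ge 0\}$. For $x\in\mathcal{K}^k$, its reflection is $x'=(x_0,-\overline{x})$. For $d\in\mathbb{R}^k$, $H_d^k=\{x\in\mathbb{R}^k\mid d^Tx\ge 0\}$ and $\mathrm{h}_d^k=\{\alpha d\mid\alpha\ge 0\}$. An extended second order cone is a direct product $K=K^{n_1}\times\cdots\times K^{n_m}\subseteq\mathbb{R}^n$, $n=n_1+\cdots+n_m$, where each $K^{n_i}\subseteq\mathbb{R}^{n_i}$ is one of: $\{0\}$; $\mathbb{R}^{n_i}$; the Lorentz cone $\mathcal{K}^{n_i}$; a half-space $H_d^{n_i}$ with $d\in\mathcal{K}^{n_i}\setminus\{0\}$; a half-line $\mathrm{h}_d^{n_i}$ with $d\in\mathcal{K}^{n_i}$. For $x\in\mathbb{R}^n$, $x_{n_i}\in\mathbb{R}^{n_i}$ denotes the $i$-th block of $x$. For $a\in K$, $\mathcal{H}_1(a,K)=\{i\mid K^{n_i}=\mathcal{K}^{n_i},\ a_{n_i}\in\mathrm{ri}\,\mathcal{K}^{n_i}\}$ and $\mathcal{H}_2(a,K)=\{i\mid K^{n_i}=\mathcal{K}^{n_i},\ a_{n_i}\in(\mathrm{relbd}\,\mathcal{K}^{n_i})\setminus\{0\}\}$,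 where $\mathrm{ri}$ is the relative interior and $\mathrm{relbd}$ the relative boundary. For a closed convex cone $K$, a linear subspace $L$ of $\mathbb{R}^n$ and $c\in\mathbb{R}^n$, $(K,L,c)$ denotes the feasibility problem: find $x\in K\cap(L+c)$. It is strongly feasible if $(L+c)\cap\mathrm{ri}\,K\ne\emptyset$; weakly feasible if $K\cap(L+c)\ne\emptyset$ but $(L+c)\cap\mathrm{ri}\,K=\emptyset$; weakly infeasible if $K\cap(L+c)=\emptyset$ but the distance between $K$ and $L+c$ is $0$; strongly infeasible if $K\cap(L+c)=\emptyset$ and the distance between $K$ and $L+c$ is positive. It is in weak status if it is weakly feasible or weakly infeasible. *)

(* Defs.v *)
From HB Require Import structures.
From mathcomp Require Import all_boot all_order all_algebra.
From mathcomp Require Import boolp classical_sets reals ereal topology normedtype.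
Set Implicit Arguments.
Unset Strict Implicit.
Unset Printing Implicit Defensive.
Import Order.TTheory GRing.Theory Num.Theory.
Import numFieldTopology.Exports.
Local Open Scope classical_set_scope.
Local Open Scope ring_scope.

(* The norm that MathComp-Analysis puts on row vectors is the sup norm, so the
   Euclidean one is defined here. The topology of 'rV[R]_n is the usual one. *)
Definition dot (R : realType) (n : nat) (x y : 'rV[R]_n) : R :=
  \sum_(j < n) x ord0 j * y ord0 j.

Definition enorm (R : realType) (n : nat) (x : 'rV[R]_n) : R :=
  Num.sqrt (dot x x).

(* The infimum is taken in the extended reals, so that the distance to the
   empty set is +oo. *)
Definition edistance (R : realType) (n : nat) (A B : set 'rV[R]_n) : \bar R :=
  ereal_inf [set (enorm (x - y))%:E | x in A & y in B].

Definition affine_hull (R : realType) (n : nat) (C : set 'rV[R]_n) :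
    set 'rV[R]_n :=
  [set x | exists (q : nat) (w : 'I_q -> R) (p : 'I_q -> 'rV[R]_n),
     [/\ forall i, C (p i), \sum_(i < q) w i = 1
       & x = \sum_(i < q) w i *: p i]].

Definition ri (R : realType) (n : nat) (C : set 'rV[R]_n) : set 'rV[R]_n :=
  [set x | C x /\ \forall y \near x, affine_hull C y -> C y].

Definition relbd (R : realType) (n : nat) (C : set 'rV[R]_n) : set 'rV[R]_n :=
  closure C `\` ri C.

(* A block is a subset of R^(k+1): blocks have positive dimension, and the
   coordinates are x_0, ..., x_k. *)
Definition lorentz (R : realType) (k : nat) : set 'rV[R]_k.+1 :=
  [set x | enorm (col' ord0 x) <= x ord0 ord0].
Arguments lorentz : clear implicits.

Definition reflection (R : realType) (k : nat) (x : 'rV[R]_k.+1) :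
    'rV[R]_k.+1 :=
  \row_j (if j == ord0 then x ord0 j else - x ord0 j).

Definition half_space (R : realType) (n : nat) (d : 'rV[R]_n) : set 'rV[R]_n :=
  [set x | 0 <= dot d x].

Definition half_line (R : realType) (n : nat) (d : 'rV[R]_n) : set 'rV[R]_n :=
  [set x | exists2 t : R, 0 <= t & x = t *: d].

Definition is_esoc_block (R : realType) (k : nat) (C : set 'rV[R]_k.+1) : Prop :=
  [\/ C = [set 0],
      C = setT,
      C = lorentz R k
    | (exists d, [/\ lorentz R k d, d <> 0 & C = half_space d])
      \/ (exists d, lorentz R k d /\ C = half_line d)].

(* The dimension of block i is (k i).+1, and the blocks of
   x : 'rV_(\sum_i (k i).+1) are the row vectors submxrow x i. *)
Definition prod_set (R : realType) (m : nat) (k : 'I_m -> nat)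
    (K : forall i : 'I_m, set 'rV[R]_(k i).+1) :
    set 'rV[R]_(\sum_(i < m) (k i).+1) :=
  [set x | forall i, K i (submxrow x i)].

Definition H1 (R : realType) (m : nat) (k : 'I_m -> nat)
    (a : 'rV[R]_(\sum_(i < m) (k i).+1))
    (K : forall i : 'I_m, set 'rV[R]_(k i).+1) : set 'I_m :=
  [set i | K i = lorentz R (k i) /\ ri (lorentz R (k i)) (submxrow a i)].

Definition H2 (R : realType) (m : nat) (k : 'I_m -> nat)
    (a : 'rV[R]_(\sum_(i < m) (k i).+1))
    (K : forall i : 'I_m, set 'rV[R]_(k i).+1) : set 'I_m :=
  [set i | K i = lorentz R (k i) /\
     (relbd (lorentz R (k i)) `\ 0) (submxrow a i)].

Definition relaxed_block (R : realType) (m : nat) (k : 'I_m -> nat)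
    (a : 'rV[R]_(\sum_(i < m) (k i).+1))
    (K : forall i : 'I_m, set 'rV[R]_(k i).+1) (i : 'I_m) :
    set 'rV[R]_(k i).+1 :=
  if i \in H1 a K then setT
  else if i \in H2 a K then half_space (reflection (submxrow a i))
  else K i.

Definition translate (R : realType) (n : nat) (L : {vspace 'rV[R]_n})
    (c : 'rV[R]_n) : set 'rV[R]_n :=
  [set l + c | l in [set l | l \in L]].

Definition strongly_feasible (R : realType) (n : nat) (K : set 'rV[R]_n)
    (L : {vspace 'rV[R]_n}) (c : 'rV[R]_n) : Prop :=
  translate L c `&` ri K !=set0.

Definition weakly_feasible (R : realType) (n : nat) (K : set 'rV[R]_n)
    (L : {vspace 'rV[R]_n}) (c : 'rV[R]_n) : Prop :=
  K `&` translate L c !=set0 /\ translate L c `&` ri K = set0.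

Definition weakly_infeasible (R : realType) (n : nat) (K : set 'rV[R]_n)
    (L : {vspace 'rV[R]_n}) (c : 'rV[R]_n) : Prop :=
  K `&` translate L c = set0 /\ edistance K (translate L c) = 0%E.

Definition strongly_infeasible (R : realType) (n : nat) (K : set 'rV[R]_n)
    (L : {vspace 'rV[R]_n}) (c : 'rV[R]_n) : Prop :=
  K `&` translate L c = set0 /\ (0 < edistance K (translate L c))%E.

Definition weak_status (R : realType) (n : nat) (K : set 'rV[R]_n)
    (L : {vspace 'rV[R]_n}) (c : 'rV[R]_n) : Prop :=
  weakly_feasible K L c \/ weakly_infeasible K L c.

(* Main.v *)
Require Import Defs.
From mathcomp Require Import all_boot all_order all_algebra.
From mathcomp Require Import boolp classical_sets reals ereal topology normedtype.
From mathcomp Require Import ring lra.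
Import Order.TTheory GRing.Theory Num.Theory.
Import numFieldTopology.Exports.
Local Open Scope classical_set_scope.
Local Open Scope ring_scope.
Set Implicit Arguments.
Unset Strict Implicit.
Unset Printing Implicit Defensive.

(** Write a' for the reflection of (a block of) [a], and C' for the relaxation
of a block C at [a]. The point is that
moving along [a], which stays inside [L + c], brings back into C whatever was
gained by passing to C'.

If [a] is interior to the Lorentz cone, then x + t a is interior to it for all
large t, whatever x is. If [a] is a nonzero boundary point, the quadratic form
x_0^2 - |tail x|^2 vanishes at [a], and along the ray x + t a it is an affine
function of t with slope 2 <a', x>; hence x + t a is eventually interior as
soon as <a', x> > 0 ([near_ri_lorentz_half_space]). In a block that is not
relaxed, adding t a preserves both the cone and its relative interior.

For strong feasibility, all relative interiors are computed block by block
([ri_prod]), where ri C is included in ri C' ([ri_sub_relaxation]) and a point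
of ri C' is driven into ri C by adding t a ([near_ri_relaxation]). As there are
finitely many blocks, one t serves all of them.

For strong infeasibility, K is included in its relaxation, so a positive
distance from the relaxation to [L + c] bounds that from K. Conversely, a point
x of the relaxation may satisfy only <a', x> >= 0, but an arbitrarily small
perturbation makes this strict, after which x + t a lies in K
([near_relaxation]). Adding t a also to the point of [L + c] being compared
with x leaves the difference of the two points unchanged, so that the distance
to [L + c] is the same for K as for its relaxation.

Weak status means that neither of the two other statuses holds ([weak_statusP]), so its
invariance follows from theirs. *)

(** * The Euclidean norm *)

Lemma dotC (R : realType) n (x y : 'rV[R]_n) : dot x y = dot y x.
Proof. by apply: eq_bigr => j _; rewrite mulrC. Qed.

Lemma dotDl (R : realType) n (x y z : 'rV[R]_n) :
  dot (x + y) z = dot x z + dot y z.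
Proof. by rewrite -big_split; apply: eq_bigr => j _; rewrite mxE mulrDl. Qed.

Lemma dotZl (R : realType) n t (x z : 'rV[R]_n) : dot (t *: x) z = t * dot x z.
Proof. by rewrite mulr_sumr; apply: eq_bigr => j _; rewrite mxE mulrA. Qed.

Lemma dotDr (R : realType) n (x y z : 'rV[R]_n) :
  dot z (x + y) = dot z x + dot z y.
Proof. by rewrite dotC dotDl !(dotC z). Qed.

Lemma dotZr (R : realType) n t (x z : 'rV[R]_n) : dot z (t *: x) = t * dot z x.
Proof. by rewrite dotC dotZl (dotC z). Qed.

Lemma dot_ge0 (R : realType) n (x : 'rV[R]_n) : 0 <= dot x x.
Proof. by apply: sumr_ge0 => j _; rewrite -expr2 sqr_ge0. Qed.

Lemma dot_eq0 (R : realType) n (x : 'rV[R]_n) : dot x x = 0 -> x = 0.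
Proof.
move=> x0; apply/rowP => j; rewrite mxE; apply/eqP; rewrite -sqrf_eq0 expr2.
by apply/eqP/(psumr_eq0P _ x0) => // i _; rewrite -expr2 sqr_ge0.
Qed.

Lemma enorm_ge0 (R : realType) n (x : 'rV[R]_n) : 0 <= enorm x.
Proof. exact: sqrtr_ge0. Qed.

Lemma enorm_sqr (R : realType) n (x : 'rV[R]_n) : enorm x ^+ 2 = dot x x.
Proof. by rewrite sqr_sqrtr// dot_ge0. Qed.

Lemma enorm0 (R : realType) n : enorm (0 : 'rV[R]_n) = 0.
Proof. by rewrite /enorm -(scale0r 0) dotZl mul0r sqrtr0. Qed.

Lemma enorm_leP (R : realType) n (x : 'rV[R]_n) (r : R) : 0 <= r ->
  (enorm x <= r) = (dot x x <= r ^+ 2).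
Proof. by move=> r0; rewrite -enorm_sqr ler_sqr// nnegrE enorm_ge0. Qed.

Lemma enorm_ltP (R : realType) n (x : 'rV[R]_n) (r : R) : 0 <= r ->
  (enorm x < r) = (dot x x < r ^+ 2).
Proof. by move=> r0; rewrite -enorm_sqr ltr_sqr// nnegrE enorm_ge0. Qed.

Lemma enormZ (R : realType) n t (x : 'rV[R]_n) : 0 <= t ->
  enorm (t *: x) = t * enorm x.
Proof.
move=> t0; rewrite /enorm dotZl dotZr mulrA -expr2 sqrtrM ?sqr_ge0//.
by rewrite sqrtr_sqr ger0_norm.
Qed.

Lemma enormN (R : realType) n (x : 'rV[R]_n) : enorm (- x) = enorm x.
Proof. by rewrite /enorm -scaleN1r dotZl dotZr mulrA mulrNN !mul1r. Qed.

Lemma cauchy_schwarz (R : realType) n (x y : 'rV[R]_n) :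
  dot x y <= enorm x * enorm y.
Proof.
suff le_sqr : dot x y ^+ 2 <= (enorm x * enorm y) ^+ 2.
  apply: le_trans (ler_norm _) _.
  by rewrite -ler_sqr ?nnegrE ?mulr_ge0 ?enorm_ge0// real_normK ?num_real.
rewrite exprMn !enorm_sqr.
have [y0|yN0] := eqVneq (dot y y) 0.
  rewrite (dot_eq0 y0) -(scale0r 0) !dotZr; lra.
have yy_gt0 : 0 < dot y y by rewrite lt_def yN0 dot_ge0.
have := dot_ge0 (dot y y *: x + (- dot x y) *: y).
rewrite !(dotDl, dotDr) !(dotZl, dotZr) (dotC y x) => ge0.
(* ge0 is the claim multiplied by dot y y *)
rewrite -subr_ge0 -(pmulr_rge0 _ yy_gt0); nra.
Qed.

Lemma enormD (R : realType) n (x y : 'rV[R]_n) :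
  enorm (x + y) <= enorm x + enorm y.
Proof.
rewrite enorm_leP ?addr_ge0 ?enorm_ge0// !(dotDl, dotDr) (dotC y x).
have := cauchy_schwarz x y; have := enorm_sqr x; have := enorm_sqr y; nra.
Qed.

Lemma enorm_le_coord (R : realType) n (x : 'rV[R]_n) (r : R) :
  (forall j, `|x ord0 j| <= r) -> enorm x <= n%:R * r.
Proof.
case: n x => [|n] x le_r.
  by rewrite mul0r [x]thinmx0 enorm0.
have r0 : 0 <= r := le_trans (normr_ge0 _) (le_r ord0).
rewrite enorm_leP ?mulr_ge0//.
apply: (@le_trans _ _ (\sum_(j < n.+1) r ^+ 2)).
  apply: ler_sum => j _; rewrite -expr2 -real_normK ?num_real//.
  by rewrite ler_sqr ?nnegrE.
rewrite sumr_const card_ord -[leLHS]mulr_natl exprMn ler_wpM2r ?sqr_ge0//.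
by rewrite expr2 ler_peMr ?ler0n// ler1n.
Qed.

(** The topology of row vectors is that of the sup norm, so neighbourhoods can
be taken to be boxes. Boxes restrict well to blocks, which is what the
computation of the relative interior of a product requires. *)
Lemma nbhs_coordP (R : realType) n (x : 'rV[R]_n) (P : set 'rV[R]_n) :
  (\forall y \near x, P y) <->
  exists2 e : R, 0 < e &
    forall y : 'rV[R]_n, (forall j, `|x ord0 j - y ord0 j| < e) -> P y.
Proof.
split=> [/(@nbhs_ballP R 'rV[R]_n)[e /= e0 eP]|[e e0 eP]].
  by exists e => // y xy; apply: eP; split=> // i j; rewrite [i]ord1; apply: xy.
by apply/(@nbhs_ballP R 'rV[R]_n); exists e => //= y [_ xy]; apply: eP => j; apply: xy.
Qed.

(** * Relative interiors of convex cones *)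

Record convex_cone (R : realType) n (C : set 'rV[R]_n) : Prop := ConvexCone {
  cone0 : C 0;
  coneD : forall x y, C x -> C y -> C (x + y);
  coneZ : forall t x, 0 <= t -> C x -> C (t *: x) }.

(** An affine combination is a difference of two conic combinations, once its
weights are sorted by sign. Conversely u - v is the affine combination
u - v + 0: the vertex 0 brings the sum of the weights back to 1. *)
Lemma affine_hull_cone (R : realType) n (C : set 'rV[R]_n) :
  convex_cone C -> affine_hull C = [set u - v | u in C & v in C].
Proof.
move=> [C0 CD CZ]; apply/seteqP;
  split=> [_ [q [w [p [Cp _ ->]]]]|_ [u Cu [v Cv <-]]].
  apply: (big_ind [set u - v | u in C & v in C]) => [|x y|i _].
  - by exists 0 => //; exists 0 => //; rewrite subr0.
  - move=> [u Cu [v Cv <-]] [u' Cu' [v' Cv' <-]].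
    exists (u + u'); first exact: CD.
    by exists (v + v'); [exact: CD|rewrite opprD addrACA].
  - have [w0|/ltW w0] := leP 0 (w i).
      exists (w i *: p i); first exact: CZ.
      by exists 0 => //; rewrite subr0.
    exists 0 => //; exists (- w i *: p i).
      by apply: CZ => //; rewrite oppr_ge0.
    by rewrite sub0r scaleNr opprK.
exists 3%N, (fun i => nth 0 [:: 1; -1; 1] i), (fun i => nth 0 [:: u; v; 0] i).
rewrite !big_ord_recl !big_ord0 /= scale1r scaleN1r scaler0 !addr0.
by split=> [[[|[|[|?]]] ?]|//|//]; rewrite //= addrA subrr add0r.
Qed.

Lemma ri_cone (R : realType) n (C : set 'rV[R]_n) x : convex_cone C ->
  ri C x <-> C x /\ \forall y \near x, [set u - v | u in C & v in C] y -> C y.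
Proof. by move=> cC; rewrite /ri /= affine_hull_cone. Qed.

Lemma ri_coneD (R : realType) n (C : set 'rV[R]_n) x v :
  convex_cone C -> ri C x -> C v -> ri C (x + v).
Proof.
move=> cC /(ri_cone _ cC)[Cx /nbhs_coordP[e e0 eP]] Cv.
have CD := coneD cC.
apply/ri_cone => //; split; first exact: CD.
apply/nbhs_coordP; exists e => // y xy [u1 Cu1 [u2 Cu2 yE]].
rewrite -(subrK v y); apply: (CD) => //; apply: eP => [j|].
  by have := xy j; rewrite !mxE; congr (`|_| < e); ring.
exists u1 => //; exists (u2 + v); first exact: CD.
by rewrite -yE opprD addrA.
Qed.

(** Necessary conditions for being relatively interior come from this lemma,
with v the axis of the Lorentz cone or the normal of a half-space. *)
Lemma ri_cone_sub (R : realType) n (C : set 'rV[R]_n) x v :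
  convex_cone C -> ri C x -> C v -> exists2 e : R, 0 < e & C (x - e *: v).
Proof.
move=> cC /(ri_cone _ cC)[Cx /nbhs_coordP[e e0 eP]] Cv.
(* s dominates strictly every coordinate of v, and is positive even if v = 0 *)
pose s := 1 + \sum_j `|v ord0 j|.
have s0 : 0 < s by rewrite ltr_wpDr// sumr_ge0.
have es0 : 0 < e / s by rewrite divr_gt0.
exists (e / s) => //; apply: eP => [j|]; last first.
  by exists x => //; exists (e / s *: v) => //; apply: (coneZ cC) => //; exact: ltW.
rewrite !mxE opprB addrC subrK normrM gtr0_norm// mulrAC ltr_pdivrMr// ltr_pM2l//.
rewrite /s (bigD1 j)//= addrCA ltr_pwDr// ltr_wpDr ?ltr01//.
by rewrite sumr_ge0.
Qed.

(** Common source of the interior points of the Lorentz cone, with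
g x = x_0 - |tail x|, and of half-spaces, with g x = <d, x>. *)
Lemma ri_superlevel (R : realType) n (g : 'rV[R]_n -> R) (M : R) x :
  (forall y z, `|g y - g z| <= M * enorm (y - z)) -> 0 < g x ->
  ri [set y | 0 <= g y] x.
Proof.
move=> g_lip gx; split; first exact: ltW.
pose s := 1 + n%:R * `|M|.
have s0 : 0 < s by rewrite ltr_wpDr// mulr_ge0.
apply/nbhs_coordP; exists (g x / s); first exact: divr_gt0.
move=> y xy _ /=.
suff : M * enorm (x - y) <= g x.
  by have := g_lip x y; rewrite ler_norml => /andP[_]; lra.
have le1 : enorm (x - y) <= n%:R * (g x / s).
  by apply: enorm_le_coord => j; rewrite !mxE ltW.
apply: (@le_trans _ _ (`|M| * enorm (x - y))).
  by rewrite ler_wpM2r ?enorm_ge0// ler_norm.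
apply: le_trans (ler_wpM2l (normr_ge0 M) le1) _.
rewrite [leLHS](_ : _ = g x * (n%:R * `|M| / s)); last by ring.
by rewrite ger_pMr// ler_pdivrMr// mul1r lerDr.
Qed.

Lemma riT (R : realType) n (x : 'rV[R]_n) : ri setT x.
Proof. by split=> //; apply/nbhs_coordP; exists 1. Qed.

Lemma convex_cone_prod (R : realType) m (k : 'I_m -> nat)
    (K : forall i, set 'rV[R]_(k i).+1) :
  (forall i, convex_cone (K i)) -> convex_cone (prod_set K).
Proof.
move=> cK; split=> [i|x y Kx Ky i|t x t0 Kx i].
- by rewrite submxrow0; exact: cone0 (cK i).
- by rewrite submxrowD; apply: coneD (cK i) _ _ (Kx i) (Ky i).
- have -> : submxrow (t *: x) i = t *: submxrow x i by apply/rowP => j; rewrite !mxE.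
  exact: coneZ (cK i) _ _ t0 (Kx i).
Qed.

Lemma near_submxrow (R : realType) m (k : 'I_m -> nat)
    (x : 'rV[R]_(\sum_(i < m) (k i).+1)) i (P : set 'rV[R]_(k i).+1) :
  (\forall z \near submxrow x i, P z) -> \forall y \near x, P (submxrow y i).
Proof.
move=> /nbhs_coordP[e e0 eP]; apply/nbhs_coordP; exists e => // y xy.
by apply: eP => j; rewrite !mxE; apply: xy.
Qed.

(** For cones the affine hull is C - C, which commutes with products. From
left to right, a block z near x_i is placed into x by overwriting its block i;
the result is a difference of elements of the product, the second of which is
zero outside block i. *)
Lemma ri_prod (R : realType) m (k : 'I_m -> nat)
    (K : forall i, set 'rV[R]_(k i).+1) x : (forall i, convex_cone (K i)) ->
  ri (prod_set K) x <-> forall i, ri (K i) (submxrow x i).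
Proof.
move=> cK; have cP := convex_cone_prod cK; split.
  move=> /(ri_cone _ cP)[Kx /nbhs_coordP[e e0 eP]] i.
  apply/ri_cone => //; split=> //.
  apply/nbhs_coordP; exists e => // z xz [u Ku [v Kv uvz]].
  pose put w (z : 'rV[R]_(k i).+1) :=
    \mxrow_j @dfwith _ (fun j => 'rV[R]_(k j).+1) (submxrow w) i z j.
  have putK w z' : submxrow (put w z') i = z' by rewrite mxrowK dfwith_in.
  have put_in w z' : prod_set K w -> K i z' -> prod_set K (put w z').
    by move=> Kw Kz j; rewrite mxrowK; case: dfwithP.
  rewrite -(putK x z); apply: eP => [j|].
    rewrite -(submxrowK x) -(submxrowK (put _ z)).
    rewrite [X in `|X - _|]mxE [X in `|_ - X|]mxE !submxrowK mxrowK.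
    move: (tagnat.sig1 j) (tagnat.sig2 j) => i' j'.
    by case: dfwithP j' => [|i'' _] j'; [exact: xz|rewrite subrr normr0].
  exists (put x u); first exact: put_in.
  exists (put 0 v); first by apply: put_in => //; exact: cone0 cP.
  apply/mxrowP => j; rewrite submxrowB !mxrowK -uvz.
  have [<-|ij] := eqVneq i j; first by rewrite !dfwith_in.
  by rewrite !dfwith_out// submxrow0 subr0.
move=> riKx; apply/ri_cone => //; split=> [i|]; first by have [] := riKx i.
have near_K : \forall y \near x, forall i,
    [set u - v | u in K i & v in K i] (submxrow y i) -> K i (submxrow y i).
  apply: (@filter_forall _ _ _ _ (nbhs_filter x)) => i.
  apply: (@near_submxrow R m k x i (fun z => _ z -> K i z)).
  by have /(ri_cone _ (cK i))[] := riKx i.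
apply: (@filterS _ _ (nbhs_filter x) _ _ _ near_K) => y Ky [u Ku [v Kv uvy]] i; apply: Ky.
by exists (submxrow u i) => //; exists (submxrow v i); rewrite // -submxrowB uvy.
Qed.

(** * The Lorentz cone and half-spaces *)

Local Notation tail x := (col' ord0 x).

Lemma tailD (R : realType) k (x y : 'rV[R]_k.+1) : tail (x + y) = tail x + tail y.
Proof. by apply/rowP => j; rewrite !mxE. Qed.

Lemma tailZ (R : realType) k t (x : 'rV[R]_k.+1) : tail (t *: x) = t *: tail x.
Proof. by apply/rowP => j; rewrite !mxE. Qed.

Lemma dot_tail (R : realType) k (x y : 'rV[R]_k.+1) :
  dot x y = x ord0 ord0 * y ord0 ord0 + dot (tail x) (tail y).
Proof.
by rewrite /dot big_ord_recl; congr (_ + _); apply: eq_bigr => j _; rewrite !mxE.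
Qed.

Lemma dot_reflection (R : realType) k (a x : 'rV[R]_k.+1) :
  dot (reflection a) x = a ord0 ord0 * x ord0 ord0 - dot (tail a) (tail x).
Proof.
rewrite dot_tail mxE eqxx; congr (_ + _); rewrite -mulN1r -dotZl.
by congr dot; apply/rowP => j; rewrite !mxE/= mulN1r.
Qed.

Lemma norm_head_le (R : realType) k (x : 'rV[R]_k.+1) : `|x ord0 ord0| <= enorm x.
Proof.
rewrite -ler_sqr ?nnegrE ?enorm_ge0// real_normK ?num_real// enorm_sqr dot_tail.
by rewrite -expr2 lerDl dot_ge0.
Qed.

Lemma enorm_tail_le (R : realType) k (x : 'rV[R]_k.+1) : enorm (tail x) <= enorm x.
Proof.
by rewrite enorm_leP ?enorm_ge0// enorm_sqr (dot_tail x) lerDr -expr2 sqr_ge0.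
Qed.

Lemma convex_cone_lorentz (R : realType) k : convex_cone (lorentz R k).
Proof.
rewrite /lorentz; split=> [|x y /= Lx Ly|t x /= t0 Lx].
- by rewrite /= -(scale0r 0) tailZ scale0r enorm0 mxE mul0r.
- by rewrite tailD mxE; apply: le_trans (enormD _ _) (lerD Lx Ly).
- by rewrite tailZ enormZ// mxE ler_wpM2l.
Qed.

Lemma convex_cone_half_space (R : realType) n (d : 'rV[R]_n) :
  convex_cone (half_space d).
Proof.
rewrite /half_space; split=> [|x y /= dx dy|t x /= t0 dx].
- by rewrite /= -(scale0r 0) dotZr mul0r.
- by rewrite dotDr addr_ge0.
- by rewrite dotZr mulr_ge0.
Qed.

Lemma convex_cone_esoc_block (R : realType) k (C : set 'rV[R]_k.+1) :
  is_esoc_block C -> convex_cone C.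
Proof.
move=> [->|->|->|[[d [_ _ ->]]|[d [_ ->]]]].
- by split=> [//|_ _ -> ->|t _ _ ->]; rewrite ?addr0 ?scaler0.
- by [].
- exact: convex_cone_lorentz.
- exact: convex_cone_half_space.
- split=> [|_ _ [s s0 ->] [t t0 ->]|t _ t0 [s s0 ->]].
  + by exists 0; rewrite ?scale0r.
  + by exists (s + t); rewrite ?addr_ge0// scalerDl.
  + by exists (t * s); rewrite ?mulr_ge0// scalerA.
Qed.

(** The axis of the Lorentz cone, which lies in its interior. *)
Definition axis {R : realType} {k} : 'rV[R]_k.+1 := delta_mx ord0 ord0.

Lemma tail_axis (R : realType) k : tail (axis : 'rV[R]_k.+1) = 0.
Proof. by apply/rowP => j; rewrite !mxE. Qed.

Lemma lorentz_axis (R : realType) k : lorentz R k axis.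
Proof. by rewrite /lorentz /= tail_axis enorm0 mxE !eqxx ler01. Qed.

Lemma ri_lorentz (R : realType) k (x : 'rV[R]_k.+1) :
  ri (lorentz R k) x <-> enorm (tail x) < x ord0 ord0.
Proof.
split=> [rix|ltx].
  have [e e0] := ri_cone_sub (convex_cone_lorentz R k) rix (lorentz_axis R k).
  rewrite /lorentz /= -scaleNr tailD tailZ tail_axis scaler0 addr0 !mxE !eqxx.
  by rewrite mulr1n => le_x; apply: le_lt_trans le_x _; lra.
have -> : lorentz R k = [set y : 'rV[R]_k.+1 | 0 <= y ord0 ord0 - enorm (tail y)].
  by apply/seteqP; split=> y; rewrite /lorentz/= subr_ge0.
apply: (@ri_superlevel _ _ _ 2); last by rewrite subr_gt0.
move=> y z.
have headB := norm_head_le (y - z); have tailB := enorm_tail_le (y - z).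
have yz := enormD (tail z) (tail (y - z)); have zy := enormD (tail y) (tail (z - y)).
rewrite -tailD addrC subrK in yz; rewrite -tailD addrC subrK in zy.
rewrite -(enormN (tail (z - y))) -scaleN1r -tailZ scaleN1r opprB in zy.
rewrite !mxE in headB; move: headB; rewrite !ler_norml => /andP[? ?].
by apply/andP; split; lra.
Qed.

Lemma ri_half_space (R : realType) n (d x : 'rV[R]_n) : d <> 0 ->
  ri (half_space d) x <-> 0 < dot d x.
Proof.
move=> dN0; have dd_gt0 : 0 < dot d d.
  by rewrite lt_def dot_ge0 andbT; apply/eqP => /dot_eq0.
split=> [rix|dx].
  have [e e0] := ri_cone_sub (convex_cone_half_space d) rix (ltW dd_gt0).
  rewrite /half_space /= -scaleNr dotDr dotZr mulNr subr_ge0.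
  by apply: lt_le_trans; rewrite mulr_gt0.
apply: (@ri_superlevel _ _ _ (enorm d)) => // y z.
have := cauchy_schwarz d (y - z); have := cauchy_schwarz d (z - y).
rewrite -(enormN (z - y)) opprB -!scaleN1r !dotDr !dotZr ler_norml => ? ?.
by apply/andP; split; lra.
Qed.

Lemma reflection_neq0 (R : realType) k (a : 'rV[R]_k.+1) :
  a <> 0 -> reflection a <> 0.
Proof.
move=> aN0 /rowP ra0; apply: aN0; apply/rowP => j; have := ra0 j.
by rewrite !mxE; case: eqP => // _ /eqP; rewrite oppr_eq0 => /eqP.
Qed.

Lemma dot_reflection_ge0 (R : realType) k (a x : 'rV[R]_k.+1) :
  lorentz R k a -> lorentz R k x -> 0 <= dot (reflection a) x.
Proof.
rewrite /lorentz /= => La Lx; rewrite dot_reflection subr_ge0.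
apply: le_trans (cauchy_schwarz _ _) _.
by apply: ler_pM => //; exact: enorm_ge0.
Qed.

Lemma lorentz_head_gt0 (R : realType) k (a : 'rV[R]_k.+1) :
  lorentz R k a -> a <> 0 -> 0 < a ord0 ord0.
Proof.
rewrite /lorentz /= => La aN0; rewrite lt_def (le_trans (enorm_ge0 _) La) andbT.
apply/eqP => a0; apply: aN0; apply: dot_eq0; rewrite dot_tail a0 mul0r add0r.
rewrite -enorm_sqr; have /eqP -> : enorm (tail a) == 0.
  by rewrite eq_le enorm_ge0 andbT -a0.
by rewrite expr0n.
Qed.

(** * Translating into a Lorentz cone along one of its elements *)

Lemma near_ri_lorentz_interior (R : realType) k (a x : 'rV[R]_k.+1) :
  ri (lorentz R k) a -> \forall t \near +oo, ri (lorentz R k) (x + t *: a).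
Proof.
move=> /ri_lorentz; rewrite -subr_gt0; set s := _ - _ => s0.
near=> t; apply/ri_lorentz; rewrite tailD tailZ !mxE.
have t0 : 0 <= t by near: t; apply: nbhs_pinfty_ge; exact: num_real.
apply: le_lt_trans (enormD _ _) _; rewrite enormZ//.
suff : (enorm (tail x) - x ord0 ord0) / s < t.
  by rewrite ltr_pdivrMr// /s; lra.
by near: t; apply: nbhs_pinfty_gt; exact: num_real.
Unshelve. all: by end_near. Qed.

(** Along the ray x + t a the Lorentz form is at least
x_0^2 - |tail x|^2 + 2 t <a', x>, because it is nonnegative at [a]. *)
Lemma near_ri_lorentz_half_space (R : realType) k (a x : 'rV[R]_k.+1) :
  lorentz R k a -> 0 < dot (reflection a) x ->
  \forall t \near +oo, ri (lorentz R k) (x + t *: a).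
Proof.
move=> La ax.
have a0 : 0 < a ord0 ord0.
  apply: lorentz_head_gt0 => // aE; move: ax; rewrite dot_reflection aE.
  by rewrite -(scale0r 0) tailZ dotZl mxE !mul0r subr0 ltxx.
have aa : dot (tail a) (tail a) <= a ord0 ord0 ^+ 2.
  by rewrite -enorm_leP ?(ltW a0).
rewrite dot_reflection in ax; set s := _ - _ in ax.
(* t must make both the head and the Lorentz form of x + t a positive *)
near=> t.
have t0 : 0 < t by near: t; apply: nbhs_pinfty_gt; exact: num_real.
have head_gt0 : 0 < x ord0 ord0 + t * a ord0 ord0.
  suff : - x ord0 ord0 / a ord0 ord0 < t by rewrite ltr_pdivrMr//; lra.
  by near: t; apply: nbhs_pinfty_gt; exact: num_real.
apply/ri_lorentz; rewrite !mxE enorm_ltP ?(ltW head_gt0)//.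
rewrite tailD tailZ !(dotDl, dotDr) !(dotZl, dotZr) (dotC (tail a) (tail x)).
have : (dot (tail x) (tail x) - x ord0 ord0 ^+ 2) / (2 * s) < t.
  by near: t; apply: nbhs_pinfty_gt; exact: num_real.
rewrite ltr_pdivrMr ?mulr_gt0// /s (dotC (tail a)) => lt_t.
have : t ^+ 2 * dot (tail a) (tail a) <= t ^+ 2 * a ord0 ord0 ^+ 2.
  by rewrite ler_pM2l ?exprn_gt0.
lra.
Unshelve. all: by end_near. Qed.

(** The possible outcomes of [relaxed_block], freed from the dependence on the
product so that the lemmas below concern a single block. *)
Variant relaxation (R : realType) k (C : set 'rV[R]_k.+1) (a : 'rV[R]_k.+1) :
    set 'rV[R]_k.+1 -> Prop :=
  | RelaxInterior of C = lorentz R k & ri (lorentz R k) a : relaxation C a setT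
  | RelaxBoundary of C = lorentz R k & a <> 0 :
      relaxation C a (half_space (reflection a))
  | RelaxNone : relaxation C a C.

Lemma relaxed_blockP (R : realType) m (k : 'I_m -> nat)
    (a : 'rV[R]_(\sum_(i < m) (k i).+1)) (K : forall i, set 'rV[R]_(k i).+1) i :
  relaxation (K i) (submxrow a i) (relaxed_block a K (i:=i)).
Proof.
rewrite /relaxed_block; case: ifPn => [|_].
  by rewrite inE => -[]; exact: RelaxInterior.
case: ifPn => [|_]; last exact: RelaxNone.
by rewrite inE => -[KE [_ aN0]]; exact: RelaxBoundary.
Qed.

Section Relaxation.
Variables (R : realType) (k : nat) (C C' : set 'rV[R]_k.+1) (a : 'rV[R]_k.+1).
Hypotheses (cC : convex_cone C) (Ca : C a) (CC' : relaxation C a C').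

Lemma convex_cone_relaxation : convex_cone C'.
Proof. by case: CC' => //; move=> *; exact: convex_cone_half_space. Qed.

Lemma sub_relaxation : C `<=` C'.
Proof.
case: CC' Ca => [_ _ _ //|-> aN0 La x Lx|_ //].
by rewrite /half_space /= dot_reflection_ge0.
Qed.

(** In the boundary case, <a', x> >= a_0 (x_0 - |tail x|) by Cauchy-Schwarz. *)
Lemma ri_sub_relaxation : ri C `<=` ri C'.
Proof.
case: CC' Ca => [_ _ _|-> aN0 La|_ //] x => [_|/ri_lorentz ltx]; first exact: riT.
apply/ri_half_space; first exact: reflection_neq0.
rewrite dot_reflection subr_gt0; apply: le_lt_trans (cauchy_schwarz _ _) _.
apply: le_lt_trans (ler_wpM2r (enorm_ge0 _) La) _.
by rewrite ltr_pM2l// lorentz_head_gt0.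
Qed.

Lemma near_ri_relaxation x :
  ri C' x -> \forall t \near +oo, ri C (x + t *: a).
Proof.
case: CC' Ca => [-> ria _ _|-> aN0 La|_ rix]; first exact: near_ri_lorentz_interior.
  move=> /ri_half_space - /(_ (reflection_neq0 aN0)).
  exact: near_ri_lorentz_half_space.
near=> t.
have t0 : 0 <= t by near: t; apply: nbhs_pinfty_ge; exact: num_real.
exact: ri_coneD cC rix (coneZ cC t0 Ca).
Unshelve. all: by end_near. Qed.

(** The perturbation p is a small multiple of the axis in the boundary case,
as <a', axis> = a_0 > 0. It is 0 in the blocks that are not relaxed, which may
have empty interior. *)
Lemma near_relaxation x (e : R) : C' x -> 0 < e ->
  exists2 p : 'rV[R]_k.+1, forall j, `|p ord0 j| <= e &
    \forall t \near +oo, C (x + p + t *: a).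
Proof.
move=> + e0; case: CC' Ca => [-> ria _ _|-> aN0 La|_ C'x].
- exists 0 => [j|]; first by rewrite mxE normr0 ltW.
  by rewrite addr0; apply: filterS (near_ri_lorentz_interior x ria) => t [].
- move=> hx; exists (e *: axis) => [j|].
    rewrite !mxE/= normrM gtr0_norm// ger_pMr//.
    by case: eqP; rewrite ?normr1 ?normr0.
  have dot_gt0 : 0 < dot (reflection a) (x + e *: axis).
    rewrite dotDr dotZr ltr_wpDl// mulr_gt0// dot_reflection tail_axis mxE !eqxx.
    by rewrite -(scale0r 0) dotZr mul0r subr0 mulr1 lorentz_head_gt0.
  by apply: filterS (near_ri_lorentz_half_space La dot_gt0) => t [].
- exists 0 => [j|]; first by rewrite mxE normr0 ltW.
  near=> t; rewrite addr0.
  have t0 : 0 <= t by near: t; apply: nbhs_pinfty_ge; exact: num_real.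
  exact: coneD cC _ _ C'x (coneZ cC t0 Ca).
Unshelve. all: by end_near. Qed.

End Relaxation.

(** * Feasibility statuses *)

Lemma translate_direction (R : realType) n (L : {vspace 'rV[R]_n}) c a t x :
  a \in L -> translate L c x -> translate L c (x + t *: a).
Proof.
move=> aL [l /= lL <-]; exists (l + t *: a); last by rewrite addrAC.
by rewrite /= rpredD ?rpredZ.
Qed.

Lemma edistance_ge0 (R : realType) n (A B : set 'rV[R]_n) : (0 <= edistance A B)%E.
Proof. by apply/ereal_infP => _ [x _ [y _ <-]]; rewrite lee_fin enorm_ge0. Qed.

Lemma edistance_le0 (R : realType) n (A B : set 'rV[R]_n) x :
  A x -> B x -> (edistance A B <= 0)%E.
Proof.
move=> Ax Bx; apply: ge_ereal_inf; exists 0%E => //.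
by exists x => //; exists x => //; rewrite subrr enorm0.
Qed.

Lemma strongly_infeasibleP (R : realType) n (K : set 'rV[R]_n) L c :
  strongly_infeasible K L c <-> exists2 e : R, 0 < e &
    forall x y, K x -> translate L c y -> e <= enorm (x - y).
Proof.
split=> [[_ dist_gt0]|[e e0 le_e]].
  have [e e0 /ltW/ereal_infP le_e] : exists2 e : R, 0 < e &
      (e%:E < edistance K (translate L c))%E.
    case: (edistance _ _) dist_gt0 => [r||//].
      by rewrite lte_fin => r0; exists (r / 2); rewrite ?lte_fin; lra.
    by exists 1 => //; rewrite ltry.
  exists e => // x y Kx Ly; rewrite -lee_fin; apply: le_e.
  by exists x => //; exists y.
have dist_gt0 : (0 < edistance K (translate L c))%E.
  apply: (@lt_le_trans _ _ e%:E); first by rewrite lte_fin.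
  by apply/ereal_infP => _ [x Kx [y Ly <-]]; rewrite lee_fin le_e.
split=> //; apply/seteqP; split=> // x [Kx Lx].
by have := edistance_le0 Kx Lx; rewrite leNgt dist_gt0.
Qed.

Lemma weak_statusP (R : realType) n (K : set 'rV[R]_n) L c :
  weak_status K L c <-> ~ strongly_feasible K L c /\ ~ strongly_infeasible K L c.
Proof.
split=> [[[[x [Kx Lx]] noSF]|[KL0 dist0]]|[noSF noSI]].
- split; first by move/set0P/eqP.
  by move=> [KL0 _]; have : (K `&` translate L c) x by []; rewrite KL0.
- split; last by move=> [_]; rewrite dist0 ltxx.
  move=> [x [Lx [Kx _]]].
  by have : (K `&` translate L c) x by []; rewrite KL0.
- have [KL0|KLN0] := eqVneq (K `&` translate L c) set0; [right|left].
    split=> //; apply/eqP; rewrite eq_le edistance_ge0 andbT leNgt.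
    by apply/negP => dist_gt0; apply: noSI.
  by split; [exact/set0P|apply/eqP/negPn/negP => /set0P].
Qed.

Theorem theorem2 (R : realType) (m : nat) (k : 'I_m -> nat)
    (K : forall i : 'I_m, set 'rV[R]_(k i).+1)
    (hK : forall i : 'I_m, is_esoc_block (K i))
    (L : {vspace 'rV[R]_(\sum_(i < m) (k i).+1)})
    (c a : 'rV[R]_(\sum_(i < m) (k i).+1))
    (haK : prod_set K a) (haL : a \in L)
    (hH : H1 a K `|` H2 a K !=set0) :
  [/\ strongly_feasible (prod_set K) L c <->
        strongly_feasible (prod_set (relaxed_block a K)) L c,
      weak_status (prod_set K) L c <->
        weak_status (prod_set (relaxed_block a K)) L c
    & strongly_infeasible (prod_set K) L c <->
        strongly_infeasible (prod_set (relaxed_block a K)) L c].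
Proof.
have cK i : convex_cone (K i) := convex_cone_esoc_block (hK i).
have relK i := relaxed_blockP a K i.
have cK' i : convex_cone (relaxed_block a K (i:=i)) :=
  convex_cone_relaxation (cK i) (relK i).
have blockE x t i : submxrow (x + t *: a) i = submxrow x i + t *: submxrow a i.
  by rewrite submxrowD; congr (_ + _); apply/rowP => j; rewrite !mxE.
have SF : strongly_feasible (prod_set K) L c <->
    strongly_feasible (prod_set (relaxed_block a K)) L c.
  split=> -[x [Lx /ri_prod rix]].
    exists x; split=> //; apply/ri_prod => // i.
    exact: ri_sub_relaxation (haK i) (relK i) _ (rix cK i).
  have : \forall t \near +oo, forall i, ri (K i) (submxrow x i + t *: submxrow a i).
    apply: filter_forall => i.
    exact: near_ri_relaxation (cK i) (haK i) (relK i) _ (rix cK' i).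
  move=> /filter_ex[t riKt]; exists (x + t *: a); split; first exact: translate_direction.
  by apply/ri_prod => // i; rewrite blockE.
have SI : strongly_infeasible (prod_set K) L c <->
    strongly_infeasible (prod_set (relaxed_block a K)) L c.
  (* half of e is left for the perturbation q *)
  split=> /strongly_infeasibleP[e e0 le_e]; apply/strongly_infeasibleP; last first.
    exists e => // x y Kx Ly; apply: le_e => // i.
    exact: sub_relaxation (haK i) (relK i) _ (Kx i).
  exists (e / 2) => [|x y K'x Ly]; first lra.
  (* n.+1 keeps the divisor nonzero, and n * d <= e / 2 bounds the norm of q *)
  pose n := (\sum_(i < m) (k i).+1)%N; pose d := e / 2 / n.+1%:R.
  have d0 : 0 < d by rewrite !divr_gt0.
  have p i := cid2 (near_relaxation (cK i) (haK i) (relK i) (K'x i) d0).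
  pose q := \mxrow_i s2val (p i).
  have : \forall t \near +oo, forall i,
      K i (submxrow x i + s2val (p i) + t *: submxrow a i).
    by apply: filter_forall => i; exact: (s2valP' (p i)).
  move=> /filter_ex[t Kt].
  have enorm_q : enorm q <= e / 2.
    apply: (@le_trans _ _ (n%:R * d)).
      by apply: enorm_le_coord => j; rewrite mxE; exact: (s2valP (p _)).
    rewrite /d mulrCA ger_pMr; last by lra.
    by rewrite ler_pdivrMr ?ltr0Sn// mul1r ler_nat.
  have : e <= enorm (x + q + t *: a - (y + t *: a)).
    apply: le_e; last exact: translate_direction.
    by move=> i; rewrite blockE submxrowD mxrowK; exact: Kt.
  have -> : x + q + t *: a - (y + t *: a) = x - y + q.
    by rewrite opprD addrACA subrr addr0 addrAC.
  by have := enormD (x - y) q; lra.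
by split=> //; split=> /weak_statusP[noSF noSI]; apply/weak_statusP; tauto.
Qed.
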